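(* Let $T$ be a tree on $n\geq 3$ vertices with exactly $p$ leaves. Then the invariant factors (diagonal entries of the Smith normal form over $\mathbb{Z}$) of the integer matrix $\mathrm{Max4PC}_T$ are $$\underbrace{0,\ldots,0}_{\binom{n}{2}-2(n-p)},\ 1,\ 1,\ \underbrace{2,\ldots,2}_{2(n-p-1)}.$$
   Context: For a tree $T$ with vertex set $V$, $|V|=n$, let $d_{x,y}$ denote the distance between vertices $x,y$ in $T$. $\mathrm{Max4PC}_T$ is the $\binom{n}{2}\times\binom{n}{2}$ matrix with rows and columns indexed by the $2$-element subsets of $V$, whose entry in row $\{w,x\}$ and column $\{y,z\}$ is $\max\{d_{w,x}+d_{y,z},\ d_{w,y}+d_{x,z},\ d_{w,z}+d_{x,y}\}$. A leaf is a vertex of degree $1$. *)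

(* Defs.v *)
From mathcomp Require Import all_boot all_order all_algebra.
Set Implicit Arguments. Unset Strict Implicit. Unset Printing Implicit Defensive.
Import Order.TTheory GRing.Theory Num.Theory.

Definition simple_graph (V : finType) (e : rel V) : Prop :=
  symmetric e /\ irreflexive e.

Definition acyclic (V : finType) (e : rel V) : Prop :=
  forall c : seq V, uniq c -> 3 <= size c -> ~~ cycle e c.

Definition connected (V : finType) (e : rel V) : Prop :=
  forall x y : V, connect e x y.

Definition is_tree (V : finType) (e : rel V) : Prop :=
  [/\ simple_graph e, connected e & acyclic e].

Definition degree (V : finType) (e : rel V) (v : V) : nat := #|[set w | e v w]|.

Definition leaves (V : finType) (e : rel V) : {set V} := [set v | degree e v == 1].

Definition walkb (V : finType) (e : rel V) (x y : V) (k : nat) : bool :=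
  [exists t : k.-tuple V, path e x t && (last x t == y)].

(* graph distance: least k with a walk of length k from x to y
   (in a connected graph, such k is < #|V|). *)
Definition dist (V : finType) (e : rel V) (x y : V) : nat :=
  find (walkb e x y) (iota 0 #|V|).

Definition pairs2 (V : finType) := {S : {set V} | #|S| == 2}.

(* entry of Max4PC at row {w,x}, column {y,z}:
   max { d(w,x)+d(y,z), d(w,y)+d(x,z), d(w,z)+d(x,y) }.
   Since every labelling (w,x) of A and (y,z) of B yields the same three
   sums (permuted), we take the max over all labellings. *)
Definition max4pc_entry (V : finType) (e : rel V) (A B : {set V}) : nat :=
  \max_(w in A) \max_(x in A | x != w) \max_(y in B) \max_(z in B | z != y)
     maxn (dist e w x + dist e y z)
          (maxn (dist e w y + dist e x z) (dist e w z + dist e x y)).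

Definition Max4PC (V : finType) (e : rel V) : 'M[int]_(#|{: pairs2 V}|) :=
  \matrix_(i, j) Posz (max4pc_entry e (val (enum_val i)) (val (enum_val j))).

Definition diag_seq (m : nat) (d : seq int) : 'M[int]_m :=
  \matrix_(i, j) (d`_i *+ (i == j :> nat))%R.

(* Main.v *)
Require Import Defs.
From mathcomp Require Import all_boot all_order all_algebra zify.
Import GRing.Theory.

(** For 2-subsets [A] and [B] of the vertices, the four-point condition gives
      max(A, B) = d_A + d_B + 2 N(A, B),
    where [d_A] is the distance between the two elements of [A] and [N(A, B)] is the number of
    edges separating [A] from [B].  Write [a_f(A) = 1] when [A] lies on the side of the tip of the
    arc [f], and [a_f(A) = 0] otherwise; then [N(A, B)] is the sum over all arcs [f] of
    [a_f(A) a_{rev f}(B)].  Arcs at a leaf contribute nothing, since one side of such an arc is a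
    single vertex.  Hence Max4PC = U^T K U, where the rows of [U] are [d], [1] and the [a_f] for
    the 2(n-p-1) remaining arcs, and [K] is, up to a permutation of its columns,
    diag(1, 1, 2, ..., 2).

    It remains to see that [U] has an integral right inverse.  If v - u - w is a path, then
    [{u, v}] and [{v, w}] lie on the same side of every arc except the one from [w] to [u], so the
    difference of their indicators is sent to -1 by [d], to 0 by [1], and to 0 or 1 by the [a_f],
    with the value 1 only on that arc.  Taking [w] to be a leaf isolates [d], taking [w] and [u]
    not to be leaves then isolates each [a_f], and any single pair takes care of [1]. *)

(** * Matrices factoring through split injections *)

Section SplitInjections.

Set Implicit Arguments.
Unset Strict Implicit.
Local Open Scope ring_scope.

(** A left inverse forces every diagonal entry of the Smith form of [A] to be a unit. These units
    and the right factor can then be moved to the left of [pid_mx]. *)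
Lemma left_inverse_pid m k (A : 'M[int]_(m, k)) (A' : 'M[int]_(k, m)) :
  A' *m A = 1%:M ->
  (k <= m)%N /\ exists2 L : 'M[int]_m, L \in unitmx & A = L *m pid_mx k.
Proof.
have [L Lu [R Ru [d _ ->]]] := int_Smith_normal_form A.
set D := (\matrix_(i, j) _) => inv.
have {inv} : (R *m A' *m L) *m D = 1%:M.
  by rewrite -!mulmxA; apply: mulmx1C; rewrite -!mulmxA in inv *.
move: (R *m _ *m _) => X XD.
have diagE (j : 'I_k) : exists2 i : 'I_m, i = j :> nat & X j i * d`_j = 1.
  have := congr1 (fun M : 'M_k => M j j) XD; rewrite !mxE eqxx /=.
  have [lt|le] := ltnP j m.
    rewrite (bigD1 (Ordinal lt)) //= mxE eqxx mulr1n big1 ?addr0 => [<-|i ne].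
      by exists (Ordinal lt).
    by rewrite mxE -[j : nat]/(Ordinal lt : nat) val_eqE (negPf ne) mulr0.
  rewrite big1 // => i _; rewrite mxE ltn_eqF ?mulr0 //.
  exact: leq_trans le.
have le_km : (k <= m)%N.
  rewrite leqNgt; apply/negP => lt_mk.
  by have [i /= ei _] := diagE (Ordinal lt_mk); have := ltn_ord i; rewrite ei ltnn.
split=> //; have du (j : 'I_k) : d`_j \is a GRing.unit.
  by have [i _ Xd] := diagE j; apply/unitrPr; exists (X j i); rewrite mulrC.
have [r Em] : exists r, m = (k + r)%N by exists (m - k)%N; rewrite subnKC.
subst m => {X XD diagE A A'}.
(* [Q] is the upper block of the diagonal factor times [R]. Padded with an identity block, it acts
   from the left. *)
pose Q := diag_mx (\row_(j < k) d`_j) *m R.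
exists (L *m block_mx Q 0 0 1%:M).
  rewrite unitmx_mul Lu block_diag_mx_unit unitmx1 andbT unitmx_mul Ru andbT.
  rewrite unitmxE det_diag /=; apply/rpred_prod => j _; rewrite mxE; exact: du.
rewrite pid_mx_col -!mulmxA mul_block_col !mul0mx !mulmx0 !addr0 mulmx1.
rewrite -(mul0mx r R) -mul_col_mx; congr (_ *m (_ *m _)).
apply/matrixP => i j; case: (split_ordP i) => i' ->; rewrite ?col_mxEu ?col_mxEd !mxE /=.
  rewrite -val_eqE /=; by case: eqP => [->|].
by rewrite gtn_eqF ?mulr0n // (leq_trans (ltn_ord j)) // leq_addr.
Qed.

(** The previous lemma, applied to [A] and to the transpose of [B], replaces both by [pid_mx]. This
    only pads [diag_seq k s] with zeros, in agreement with [s] from index [k] on. *)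
Lemma smith_of_factor m k (A : 'M[int]_(m, k)) (B : 'M[int]_(k, m)) A' B' s :
  A' *m A = 1%:M -> B *m B' = 1%:M -> (forall i, (k <= i)%N -> s`_i = 0) ->
  exists2 L : 'M[int]_m, L \in unitmx & exists2 R : 'M[int]_m, R \in unitmx &
    A *m diag_seq k s *m B = L *m diag_seq m s *m R.
Proof.
move=> /left_inverse_pid [le_km [L Lu ->]] /(congr1 trmx).
rewrite trmx_mul trmx1 => /left_inverse_pid [_ [R Ru /(congr1 trmx)]].
rewrite trmxK trmx_mul tr_pid_mx => -> s0.
exists L => //; exists R^T; first by rewrite unitmx_tr.
have [r Em] : exists r, m = (k + r)%N by exists (m - k)%N; rewrite subnKC.
subst m; rewrite !mulmxA; congr (_ *m _); rewrite -!mulmxA; congr (_ *m _).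
rewrite pid_mx_col pid_mx_row mul_mx_row mulmx0 mulmx1 mul_col_mx mul1mx mul0mx.
apply/matrixP => i j; case: (split_ordP i) => i' ->; rewrite ?col_mxEu ?col_mxEd !mxE.
  case: (split_ordP j) => j' ->; rewrite ?row_mxEl ?row_mxEr !mxE //=.
  by rewrite ltn_eqF // (leq_trans (ltn_ord i')) // leq_addr.
by rewrite /= s0 ?leq_addr // mul0rn.
Qed.

(** Duality with [c] gives the matrix of the [phi t] an integral right inverse. The permutation
    [tau] is absorbed into the left factor, so that the weights [ev] stay diagonal. *)
Lemma smith_of_dual_systems m k (T : finType) (M : 'M[int]_m) (idx : 'I_k -> T)
    (tau : T -> T) (phi : T -> 'I_m -> int) (c : T -> 'I_m -> int) (s : seq int) (ev : T -> int) :
  bijective idx -> injective tau ->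
  (forall t u, \sum_i phi t i * c u i = (t == u)%:R) ->
  (forall j : 'I_k, s`_j = ev (idx j)) -> (forall i, (k <= i)%N -> s`_i = 0) ->
  (forall i j, M i j = \sum_t phi (tau t) i * ev t * phi t j) ->
  exists2 L : 'M[int]_m, L \in unitmx & exists2 R : 'M[int]_m, R \in unitmx &
    M = L *m diag_seq m s *m R.
Proof.
move=> bij tau_inj dual evE s0 ME.
pose A : 'M_(m, k) := \matrix_(i, j) phi (tau (idx j)) i.
pose A' : 'M_(k, m) := \matrix_(j, i) c (tau (idx j)) i.
pose B : 'M_(k, m) := \matrix_(j, i) phi (idx j) i.
pose B' : 'M_(m, k) := \matrix_(i, j) c (idx j) i.
have -> : M = A *m diag_seq k s *m B.
  apply/matrixP => i j; rewrite ME (reindex idx) /=; last exact: onW_bij.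
  rewrite !mxE; apply: eq_bigr => t _; rewrite !mxE; congr (_ * _).
  rewrite (bigD1 t) //= !mxE eqxx mulr1n evE big1 ?addr0 // => u ut.
  by rewrite !mxE val_eqE (negPf ut) mulr0n mulr0.
have idx_inj := bij_inj bij.
apply: (@smith_of_factor _ _ A B A' B') => //.
  apply/matrixP => i j; rewrite !mxE -(inj_eq idx_inj) -(inj_eq tau_inj) eq_sym -dual.
  by apply: eq_bigr => t _; rewrite !mxE mulrC.
apply/matrixP => i j; rewrite !mxE -(inj_eq idx_inj) -dual.
by apply: eq_bigr => t _; rewrite !mxE.
Qed.

End SplitInjections.

(** * Distances, sides of arcs and leaves in a tree *)

Section TreeMetric.

Set Implicit Arguments.
Unset Strict Implicit.

Variables (V : finType) (e : rel V).
Hypothesis tree : is_tree e.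

Let d := dist e.

Lemma tree_sym : symmetric e.
Proof. by case: tree => -[]. Qed.

Lemma tree_irr : irreflexive e.
Proof. by case: tree => -[]. Qed.

(** A walk shortens to one without repeated vertices, of length below [#|V|], so the search in
    [dist] succeeds. *)
Lemma dist_geodesic x y : exists2 p, path e x p /\ last x p = y & size p = d x y.
Proof.
have [_ conn _] := tree.
have /(nth_find 0) : has (walkb e x y) (iota 0 #|V|).
  have /connectP [q eq ->] := conn x y.
  have [p ep up _] := shortenP eq.
  apply/hasP; exists (size p); last first.
    by apply/existsP; exists (in_tuple p); rewrite ep eqxx.
  rewrite mem_iota /= add0n -[(size p).+1]/(size (x :: p)).
  by rewrite -(card_uniqP up) max_card.
have lt : d x y < #|V| -> nth 0 (iota 0 #|V|) (d x y) = d x y.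
  by move=> lt; rewrite nth_iota.
case: (ltnP (d x y) #|V|) => [/lt|le]; rewrite -/(dist e x y) -/d.
  move=> -> /existsP [t /andP [et /eqP lt']].
  by exists t; rewrite ?size_tuple.
(* Out of range, [nth] returns 0, so there is a walk of length 0 and [x = y]; but then the search
   already stops at index 0. *)
rewrite nth_default ?size_iota // => /existsP [t /andP [_ /eqP]].
rewrite (tuple0 t) /= => exy; move: le; rewrite -exy /d /dist.
have xx : walkb e x x 0 by apply/existsP; exists [tuple]; rewrite /= eqxx.
have : 0 < #|V| by apply/card_gt0P; exists x.
by case: #|V| => [//|k _] /=; rewrite xx.
Qed.

Lemma dist_le_path x p : path e x p -> d x (last x p) <= size p.
Proof.
move=> ep; rewrite /d /dist leqNgt; apply/negP => lt.
have := before_find 0 lt; rewrite nth_iota; last first.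
  by apply: leq_trans lt _; rewrite -[X in _ <= X](size_iota 0) find_size.
by move/existsP; case; exists (in_tuple p); rewrite ep eqxx.
Qed.

Lemma dist_xx x : d x x = 0.
Proof. by have /(_ isT) := @dist_le_path x [::]; rewrite leqn0 => /eqP. Qed.

Lemma dist_eq0 x y : (d x y == 0) = (x == y).
Proof.
apply/eqP/eqP => [d0|->]; last exact: dist_xx.
have [p [_ lp]] := dist_geodesic x y.
by rewrite d0 => p0; rewrite -lp (size0nil p0).
Qed.

Lemma dist_sym x y : d x y = d y x.
Proof.
suff le u v : d u v <= d v u by apply/eqP; rewrite eqn_leq !le.
have [p [ep <-]] := dist_geodesic v u; move=> <-.
have := @dist_le_path (last v p) (rev (belast v p)).
rewrite rev_path (eq_path (e' := e)); last by move=> a b; rewrite /= tree_sym.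
move=> /(_ ep); rewrite size_rev size_belast.
by case: p ep => [|a p] //= _; rewrite rev_cons last_rcons.
Qed.

Lemma dist_edge_le x u v : e u v -> d x v <= (d x u).+1.
Proof.
move=> euv; have [p [ep lp] <-] := dist_geodesic x u.
have := @dist_le_path x (rcons p v).
by rewrite last_rcons size_rcons rcons_path ep lp euv; apply.
Qed.

Lemma dist_pred x u : x != u -> exists2 w, e u w & (d x w).+1 = d x u.
Proof.
rewrite -dist_eq0 (dist_sym x).
have [[|w p] [/= ep lp] sp] := dist_geodesic u x; rewrite -sp //= => _.
case/andP: ep => euw ep; exists w => //.
apply/eqP; rewrite eqSS eqn_leq (dist_sym x) -{1}lp dist_le_path //=.
by rewrite -ltnS sp dist_sym (dist_sym w) dist_edge_le // tree_sym.
Qed.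

(** Along a geodesic from [w] to [x], every later vertex is closer to [x] than [u] is, so [u] is
    never met. *)
Lemma path_avoid x u w : w != u -> d x w <= d x u ->
  connect [rel a b | [&& e a b, a != u & b != u]] w x.
Proof.
have [k] := ubnP (d x w); elim: k w => // k IH w; rewrite ltnS => lek wu le.
have [->|xw] := eqVneq x w; first exact: connect0.
have [y ewy dy] := dist_pred xw.
have yu : y != u by apply/eqP => yu; move: le; rewrite -yu; lia.
apply: connect_trans (connect1 _) (IH y _ _ _); rewrite //= ?ewy ?wu //; lia.
Qed.

(* Otherwise the geodesics from [w] and [w'] to [x] avoid [u], and they close up to a cycle
   through [u]. *)
Lemma nbr_closer_unique x u w w' : e u w -> e u w' ->
  d x w <= d x u -> d x w' <= d x u -> w = w'.
Proof.
move=> euw euw' le le'; apply/eqP/negPn/negP => neq.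
have nbrN a : e u a -> a != u by apply: contraTneq => ->; rewrite tree_irr.
set r := [rel a b | [&& e a b, a != u & b != u]].
have symr : connect_sym r.
  by apply: sym_connect_sym => a b /=; rewrite tree_sym [_ && (a != u)]andbC.
have : connect r w w'.
  apply: connect_trans (path_avoid (nbrN _ euw) le) _.
  by rewrite symr; apply: path_avoid => //; apply: nbrN.
case/connectP => q rq lq; move: neq euw'; rewrite {}lq {le' w'}.
have [p rp up _ {rq}] := shortenP rq => neq euw'; have [_ _ acyc] := tree.
case: p => [|b p] in rp up neq euw' *; first by rewrite eqxx in neq.
have avoid s : forall z, z != u -> path r z s -> u \notin z :: s.
  elim: s => [|c s IH] z zu /=; first by rewrite !inE eq_sym (negPf zu).
  case/andP => /and3P [_ _ cu] rs; rewrite inE negb_or eq_sym zu /=.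
  exact: IH.
have ew : path e w (b :: p) by apply: sub_path rp => y z /and3P [].
have := acyc (u :: w :: b :: p); rewrite cons_uniq (avoid _ _ (nbrN _ euw) rp) up => /(_ isT isT).
rewrite /cycle rcons_path -[path e u _]/(e u w && path e w (b :: p)) euw ew /=.
by rewrite tree_sym euw'.
Qed.

(** Trees are bipartite: if [u] and [v] were equally far from [x], then [v] and the next vertex from
    [u] towards [x] would coincide by [nbr_closer_unique]. *)
Lemma dist_edge x u v : e u v -> d x v = (d x u).+1 \/ d x u = (d x v).+1.
Proof.
move=> euv; have evu : e v u by rewrite tree_sym.
have := dist_edge_le x euv; have := dist_edge_le x evu.
have [duv|] := eqVneq (d x u) (d x v); last lia.
have [xu|xu] := eqVneq x u.
  move: duv; rewrite xu dist_xx => /esym /eqP; rewrite dist_eq0 => /eqP uv.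
  by rewrite uv tree_irr in euv.
have [w euw dw] := dist_pred xu.
have vw : v = w by apply: (@nbr_closer_unique x u); rewrite // ?duv // -duv; lia.
by move: dw; rewrite -vw; lia.
Qed.

(** * Arcs and the two sides of an edge *)

Definition rev_arc (f : V * V) := (f.2, f.1).

Definition arcs : {set V * V} := [set f | e f.1 f.2].

(* The component containing [f.1] of the tree with the edge of [f] removed: [f.1] is the tip. *)
Definition side (f : V * V) : {set V} := [set x | d x f.1 < d x f.2].

Lemma rev_arcK : involutive rev_arc.
Proof. by case. Qed.

Lemma rev_arcs f : (rev_arc f \in arcs) = (f \in arcs).
Proof. by rewrite !inE tree_sym. Qed.

Lemma side_rev f x : f \in arcs -> (x \in side (rev_arc f)) = (x \notin side f).
Proof. by rewrite !inE /= => /(dist_edge x); lia. Qed.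

(** By parity, [x] is as far from [u] as [y] is from [v]. If this distance were positive, the next
    vertex from [y] towards [v] would be a neighbour of [y] no farther from [u] than [y], hence
    equal to [x], which is farther from [v]. *)
Lemma side_cross u v x y : e u v -> e x y ->
  x \in side (u, v) -> y \notin side (u, v) -> x = u /\ y = v.
Proof.
rewrite !inE /= => euv exy.
have evu : e v u by rewrite tree_sym.
have eyx : e y x by rewrite tree_sym.
have := dist_edge x euv; have := dist_edge y euv.
have := dist_edge u exy; have := dist_edge v exy.
rewrite !(dist_sym u) !(dist_sym v) => exv exu eyuv exuv lx ly.
have dxy : d x u = d y v by lia.
have [xu|xu] := eqVneq x u.
  by split=> //; apply/eqP; rewrite -dist_eq0 -dxy xu dist_xx.
have : v != y by rewrite eq_sym -dist_eq0 -dxy dist_eq0.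
case/dist_pred => z eyz dz; exfalso.
have dzu := dist_edge_le z evu.
have xz : x = z.
  apply: (@nbr_closer_unique u y) => //; rewrite (dist_sym u) (dist_sym u); first lia.
  by rewrite (dist_sym v) (dist_sym v) in dz; lia.
by move: dz; rewrite -xz (dist_sym v) (dist_sym v); lia.
Qed.

(** The geodesic from [x] to [f.1] stays in [side f], so it never uses the edge of [g], the only one
    that joins the two sides of [g]. *)
Lemma side_const f g x : f \in arcs -> g \in arcs ->
  g.1 \notin side f -> g.2 \notin side f ->
  x \in side f -> (x \in side g) = (f.1 \in side g).
Proof.
case: f g => u v [s t] /= fA gA sf tf.
have euv : e u v by move: fA; rewrite inE.
have est : e s t by move: gA; rewrite inE.
have [k] := ubnP (d x u); elim: k x => // k IH x; rewrite ltnS => lek xf.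
have [<- //|] := eqVneq u x.
case/dist_pred => y exy; rewrite !(dist_sym u) => dy.
have yf : y \in side (u, v).
  move: xf; rewrite !inE /=; have := dist_edge_le v exy; have := dist_edge_le v (_ : e y x).
  rewrite tree_sym => /(_ exy); rewrite !(dist_sym v); have := dist_edge x euv; lia.
rewrite -(IH y) //; last lia.
have eyx : e y x by rewrite tree_sym.
have [xg|xg] := boolP (x \in side (s, t)); have [yg|yg] := boolP (y \in side (s, t)) => //.
  by have [xs _] := side_cross est exy xg yg; rewrite -xs xf in sf.
by have [ys _] := side_cross est eyx yg xg; rewrite -ys yf in sf.
Qed.

(** If both ends of [g] lie on one side of [f], then [side g] is constant on the other side of [f];
    otherwise [g] is [f] or its reverse. *)
Lemma side_compatible f g w x y z : f \in arcs -> g \in arcs ->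
  w \in side f -> x \in side f -> y \notin side f -> z \notin side f ->
  w \in side g -> x \notin side g -> y \in side g -> z \notin side g -> False.
Proof.
move=> fA gA wf xf yf zf wg xg yg zg.
have efg : e f.1 f.2 by move: fA; rewrite inE.
have eg : e g.1 g.2 by move: gA; rewrite inE.
have eg' : e g.2 g.1 by rewrite tree_sym.
have eta (h : V * V) : (h.1, h.2) = h by case: h.
have [s1|s1] := boolP (g.1 \in side f); have [s2|s2] := boolP (g.2 \in side f).
- have rA : rev_arc f \in arcs by rewrite rev_arcs.
  have rs t : (t \in side (rev_arc f)) = (t \notin side f) by exact: side_rev.
  have c t := @side_const (rev_arc f) g t rA gA.
  have := c y; have := c z; rewrite !rs s1 s2 yf zf (negPf zg) yg => /(_ isT isT isT) <-.
  by move/(_ isT isT isT).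
- have := @side_cross f.1 f.2 g.1 g.2 efg eg; rewrite eta => /(_ s1 s2) [e1 e2].
  by move: xg; rewrite -(eta g) e1 e2 eta xf.
- have := @side_cross f.1 f.2 g.2 g.1 efg eg'; rewrite eta => /(_ s2 s1) [e2 e1].
  have gf : g = rev_arc f by rewrite -(eta g) e1 e2.
  by move: wg; rewrite gf side_rev // wf.
- have c t := @side_const f g t fA gA s1 s2.
  by have := c w wf; rewrite wg -(c x xf) (negPf xg).
Qed.

(** Induction along a geodesic: its last edge, from [z] to [y], contributes the arc [(z, y)], and
    every other arc contributes the same for [z] as for [y]. *)
Lemma dist_sum x y : d x y = \sum_(f in arcs) ((x \in side f) && (y \notin side f)).
Proof.
have [k] := ubnP (d x y); elim: k y => // k IH y; rewrite ltnS => lek.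
have [<-|xy] := eqVneq x y.
  by rewrite dist_xx big1 // => f _; case: (x \in side f).
have [z eyz dz] := dist_pred xy; have ezy : e z y by rewrite tree_sym.
have zyA : (z, y) \in arcs by rewrite inE.
rewrite -dz IH; last lia.
rewrite (bigD1 (z, y)) //= [RHS](bigD1 (z, y)) //=.
have xs : x \in side (z, y) by rewrite inE /= -dz.
have zs : z \in side (z, y).
  by rewrite inE /= dist_xx lt0n dist_eq0; apply: contraTneq eyz => ->; rewrite tree_irr.
have ys : y \notin side (z, y) by rewrite inE /= dist_xx ltn0.
rewrite xs zs ys add0n add1n; congr _.+1; apply: eq_bigr => -[u v] /andP [fA ne].
have euv : e u v by move: fA; rewrite inE.
have [xf|//] := boolP (x \in side (u, v)) => /=.
have [yf|yf] := boolP (y \in side (u, v)); have [zf|zf] := boolP (z \in side (u, v)) => //.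
  have [yu zv] := side_cross euv eyz yf zf.
  by move: xf ; rewrite -yu -zv inE /= -dz; lia.
by have [zu yv] := side_cross euv ezy zf yf; rewrite zu yv eqxx in ne.
Qed.

(** * The four-point condition *)

(** This is twice the number of edges separating [w], [x] from [y], [z], since both arcs of such an
    edge are counted. *)
Definition splits (w x y z : V) : nat :=
  \sum_(f in arcs) ([&& w \in side f, x \in side f, y \notin side f & z \notin side f]
    + [&& w \notin side f, x \notin side f, y \in side f & z \in side f]).

Lemma splits_neq0 w x y z : splits w x y z != 0 ->
  exists2 f, f \in arcs & [/\ w \in side f, x \in side f, y \notin side f & z \notin side f].
Proof.
rewrite /splits sum_nat_eq0 => /forallPn [f]; rewrite negb_imply => /andP [fA].
rewrite addn_eq0 negb_and !eqb0 !negbK => /orP [] /and4P [wf xf yf zf].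
  by exists f.
by exists (rev_arc f); rewrite ?rev_arcs // !side_rev // ?negbK.
Qed.

Lemma splits_disjoint w x y z : splits w x y z = 0 \/ splits w y x z = 0.
Proof.
have [->|/splits_neq0 [f fA [wf xf yf zf]]] := eqVneq (splits w x y z) 0; first by left.
have [->|/splits_neq0 [g gA [wg yg xg zg]]] := eqVneq (splits w y x z) 0; first by right.
by case: (side_compatible fA gA wf xf yf zf wg xg yg zg).
Qed.

Lemma splits_swap w x y z : d w x + d y z + splits w x y z = d w y + d x z + splits w y x z.
Proof.
(* After doubling, each distance is expanded from both ends, and the identity holds arc by arc for
   all 16 positions of the four vertices. *)
apply/eqP; rewrite -(eqn_pmul2l (isT : 0 < 2)) !mul2n -!addnn; apply/eqP.
transitivity (d w x + d x w + (d y z + d z y) + (splits w x y z + splits w x y z)).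
  by rewrite (dist_sym x w) (dist_sym z y); lia.
transitivity (d w y + d y w + (d x z + d z x) + (splits w y x z + splits w y x z)); last first.
  by rewrite (dist_sym y w) (dist_sym z x); lia.
rewrite !dist_sum /splits -!big_split; apply: eq_bigr => f _ /=.
by do 4!case: (_ \in side f).
Qed.

Lemma splitsCr w x y z : splits w x y z = splits w x z y.
Proof. by apply: eq_bigr => f _; do 4!case: (_ \in side f). Qed.

(* Edges induce at most one of the three splittings of [w, x, y, z] into two pairs, so at most one
   of the three numbers [splits] is nonzero, and the sum in [splits_swap] is the maximum. *)
Lemma four_point_max w x y z :
  maxn (d w x + d y z) (maxn (d w y + d x z) (d w z + d x y))
  = d w x + d y z + splits w x y z.
Proof.
have := splits_swap w x y z; have := splits_swap w x z y.
rewrite (dist_sym z y) -(splitsCr w x y z).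
have := splits_disjoint w x y z; have := splits_disjoint w x z y.
by have := splits_disjoint w y z x; rewrite -!(splitsCr w _ x) -(splitsCr w x y z); lia.
Qed.

(** The maximum gives the distance between the two elements of a pair without choosing a
    labelling. *)
Definition dist_set (A : {set V}) : nat := \max_(a in A) \max_(b in A) d a b.

Lemma dist_set2 w x : w != x -> dist_set [set w; x] = d w x.
Proof.
move=> wx; rewrite /dist_set.
rewrite !(big_setU1 _ _) ?inE // !big_set1 !(big_setU1 _ _) ?inE // !big_set1.
by rewrite !dist_xx (dist_sym x) /= max0n maxn0 maxnn.
Qed.

Lemma bigmax_const (I : finType) (P : pred I) (F : I -> nat) c :
  (exists i, P i) -> (forall i, P i -> F i = c) -> \max_(i | P i) F i = c.
Proof.
move=> [i Pi] Fc; apply/eqP; rewrite eqn_leq -{2}(Fc i Pi) leq_bigmax_cond // andbT.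
by apply/bigmax_leqP => j /Fc ->.
Qed.

Lemma set2_eq (A : {set V}) w x : #|A| == 2 -> w \in A -> x \in A -> x != w -> A = [set w; x].
Proof.
move=> A2 wA xA xw; apply/esym/eqP.
rewrite eqEcard (eqP A2) cards2 eq_sym xw andbT.
by apply/subsetP => a; rewrite !inE => /orP [] /eqP ->.
Qed.

(** This removes the maxima over labellings from [max4pc_entry] once all labellings give the same
    value. *)
Lemma bigmax_pairs (A : {set V}) (F : V -> V -> nat) c : #|A| == 2 ->
  (forall w x, w != x -> A = [set w; x] -> F w x = c) ->
  \max_(w in A) \max_(x in A | x != w) F w x = c.
Proof.
move=> A2 Fc; have /cards2P [a [b [ab Aab]]] := A2.
apply: bigmax_const => [|w wA]; first by exists a; rewrite Aab !inE eqxx.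
apply: bigmax_const => [|x /andP [xA xw]]; last first.
  by apply: Fc; [rewrite eq_sym | apply: set2_eq].
move: wA; rewrite Aab !inE => /orP [] /eqP ->.
  by exists b; rewrite !inE eqxx orbT eq_sym.
by exists a; rewrite !inE eqxx.
Qed.

Lemma sub_set2 (S : {set V}) w x : ([set w; x] \subset S) = (w \in S) && (x \in S).
Proof. by rewrite subUset !sub1set. Qed.

Lemma max4pc_entryE (A B : {set V}) : #|A| == 2 -> #|B| == 2 ->
  max4pc_entry e A B = dist_set A + dist_set B
    + (\sum_(f in arcs) (A \subset side f) * (B \subset side (rev_arc f))
      + \sum_(f in arcs) (A \subset side (rev_arc f)) * (B \subset side f)).
Proof.
move=> A2 B2; apply: bigmax_pairs => // w x wx ->.
apply: bigmax_pairs => // y z yz ->.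
rewrite four_point_max !dist_set2 // -big_split; congr (_ + _).
apply: eq_bigr => f fA; rewrite !sub_set2 !side_rev //.
by do 4!case: (_ \in side f).
Qed.

(** * Leaves and inner arcs *)

Lemma leaf_nbr_unique u v w : u \in leaves e -> e u v -> e u w -> v = w.
Proof.
rewrite inE => /cards1P [a Ea] euv euw.
have : v \in [set t | e u t] by rewrite inE.
have : w \in [set t | e u t] by rewrite inE.
by rewrite Ea !inE => /eqP -> /eqP ->.
Qed.

Lemma nonleaf_other_nbr u v : u \notin leaves e -> e u v -> exists2 w, e u w & w != v.
Proof.
move=> uN euv; case: (pickP [pred w | e u w & w != v]) => [w /andP [] |no]; first by exists w.
case/negP: uN; rewrite inE; apply/cards1P; exists v; apply/setP => w; rewrite !inE.
have := no w; rewrite /=; case: eqP => [->|_]; first by rewrite euv.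
by rewrite andbT.
Qed.

(** A vertex [l] farthest from some [x] is a leaf, because all its neighbours are no farther from
    [x] and so coincide. *)
Lemma exists_leaf_path : 3 <= #|V| ->
  exists l u v, [/\ l \in leaves e, u \notin leaves e, e u l, e u v & v != l].
Proof.
move=> V3; have /card_gt0P [x _] : 0 < #|V| by lia.
have /subsetPn [y _ yx] : ~~ ([set: V] \subset [set x]).
  by apply: contraL V3 => /subset_leq_card; rewrite cardsT cards1; lia.
case: (arg_maxnP (d x) (isT : xpredT x)) => l _ maxl.
have xl : x != l.
  apply: contraNneq yx => xl; have := maxl y isT.
  by rewrite -xl /= dist_xx leqn0 dist_eq0 inE eq_sym.
have [u elu du] := dist_pred xl; have eul : e u l by rewrite tree_sym.
have lL : l \in leaves e.
  rewrite inE; apply/cards1P; exists u; apply/setP => w; rewrite !inE.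
  apply/idP/eqP => [elw|-> //]; apply: (@nbr_closer_unique x l) => //; last lia.
  exact: maxl.
suff uN : u \notin leaves e.
  by have [v euv vl] := nonleaf_other_nbr uN eul; exists l, u, v.
apply/negP => uL.
(* Were [u] also a leaf, then from a third vertex [z] each of [l] and [u] would be strictly closer
   than the other. *)
have /subsetPn [z _] : ~~ ([set: V] \subset [set l; u]).
  by apply: contraL V3 => /subset_leq_card; rewrite cardsT cards2; case: (l != u); lia.
rewrite !inE => /norP [zl zu].
have [a ela da] := dist_pred zl; have [b eub db] := dist_pred zu.
move: da db; rewrite (leaf_nbr_unique lL ela elu) (leaf_nbr_unique uL eub eul); lia.
Qed.

Definition inner_arcs : {set V * V} :=
  [set f in arcs | (f.1 \notin leaves e) && (f.2 \notin leaves e)].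

Lemma rev_inner_arcs f : (rev_arc f \in inner_arcs) = (f \in inner_arcs).
Proof. by rewrite in_set rev_arcs [RHS]in_set [(_ \notin _) && _]andbC. Qed.

(** When the tip is a leaf, every other vertex reaches it through [f.2], so the side is a single
    vertex. *)
Lemma side_leaf f (A : {set V}) :
  f \in arcs -> f.1 \in leaves e -> #|A| == 2 -> (A \subset side f) = false.
Proof.
case: f => u v; rewrite inE => euv uL A2; apply: contraTF A2 => /subset_leq_card.
suff /subset_leq_card : side (u, v) \subset [set u] by rewrite cards1; lia.
apply/subsetP => x; rewrite !inE /=; apply: contraTT => /dist_pred [w euw dw].
have vw : v = w := leaf_nbr_unique uL euv euw.
by rewrite vw -dw; lia.
Qed.

Lemma sum_inner_arcs (A B : {set V}) : #|A| == 2 -> #|B| == 2 ->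
  \sum_(f in arcs) (A \subset side f) * (B \subset side (rev_arc f))
  = \sum_(f in inner_arcs) (A \subset side f) * (B \subset side (rev_arc f)).
Proof.
move=> A2 B2; rewrite (big_setID inner_arcs) /=.
rewrite [X in _ + X]big1 ?addn0 => [|f]; last first.
  rewrite in_setD => /andP [+ fA]; rewrite in_set fA /= negb_and !negbK.
  case/orP => L; first by rewrite side_leaf.
  by rewrite (@side_leaf (rev_arc f) B) ?muln0 ?rev_arcs.
by apply: eq_bigl => f; rewrite in_setI !in_set andbA andbb.
Qed.

(** Root the tree at a non-leaf [r]. Inner arcs directed away from [r] correspond, by their second
    ends, to the non-leaves other than [r], and reversal gives the remaining inner arcs. *)
Lemma card_inner_arcs : 3 <= #|V| -> #|inner_arcs| = 2 * (#|V| - #|leaves e| - 1).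
Proof.
move=> V3; have [l [r [_ [_ rN _ _ _]]]] := exists_leaf_path V3.
set down := [set f in inner_arcs | d r f.1 < d r f.2].
have dK : inner_arcs :\: down = rev_arc @: down.
  apply/setP => -[u v]; apply/idP/imsetP => [|[[a b] + [-> ->]]].
    rewrite inE => /andP []; rewrite inE => + fI; rewrite fI /= => nlt.
    exists (v, u) => //; rewrite inE (rev_inner_arcs (u, v)) fI /=.
    by move: fI; rewrite !inE => /andP [/(dist_edge r) /= + _]; lia.
  rewrite in_set /= => /andP [fI lt].
  by rewrite in_setD in_set (rev_inner_arcs (a, b)) fI /= -leqNgt ltnW.
have sub : down \subset inner_arcs by apply/subsetP => f; rewrite inE => /andP [].
have -> : #|inner_arcs| = #|down| + #|down|.
  rewrite -(cardsID down inner_arcs) (setIidPr sub) dK.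
  by rewrite card_imset //; apply: inv_inj; apply: rev_arcK.
rewrite addnn -mul2n; congr (2 * _).
have -> : #|V| - #|leaves e| - 1 = #|~: leaves e :\ r|.
  by have := cardsC (leaves e); rewrite (cardsD1 r (~: _)) inE rN; lia.
rewrite -(_ : snd @: down = ~: leaves e :\ r).
  rewrite card_in_imset // => -[a b] [a' b']; rewrite !inE /=.
  move=> /andP [/and3P [eab _ _] lt] /andP [/and3P [eab' _ _] lt'] bb'; subst b'.
  by congr (_, _); apply: (@nbr_closer_unique r b); rewrite 1?tree_sym // ltnW.
apply/setP => v; apply/imsetP/idP => [[[a b] + ->]|].
  rewrite !inE /= => /andP [/and3P [_ _ ->] lt]; rewrite andbT.
  by apply: contraTneq lt => ->; rewrite dist_xx.
rewrite !inE => /andP [vr vN]; have [w evw dw] : exists2 w, e v w & (d r w).+1 = d r v.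
  by apply: dist_pred; rewrite eq_sym.
have ewv : e w v by rewrite tree_sym.
exists (w, v) => //; rewrite !inE /= ewv -dw ltnSn andbT.
have [rw|rw] := eqVneq r w; first by move: rN; rewrite inE rw => ->.
have [z ewz dz] := dist_pred rw.
(* The parent [w] of [v], if it is not the root, has two distinct neighbours: [v] and its own parent
   [z]. *)
have wN : w \notin leaves e by apply/negP => /leaf_nbr_unique /(_ ewv ewz) vz; rewrite vz in dw; lia.
by move: wN; rewrite inE => ->.
Qed.

Local Open Scope ring_scope.

(** * Dual vectors of the distance, constant and side functionals *)

Definition pairing (phi : {set V} -> int) (c : pairs2 V -> int) : int :=
  \sum_A phi (val A) * c A.

Definition set_dirac (S : {set V}) : pairs2 V -> int := fun A => (val A == S)%:R.

Lemma pairing_dirac phi (S : {set V}) : #|S| == 2 -> pairing phi (set_dirac S) = phi S.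
Proof.
move=> S2; rewrite /pairing (bigD1 (Sub S S2 : pairs2 V)) //= /set_dirac SubK eqxx mulr1.
rewrite big1 ?addr0 // => A neA; case: eqP => [eA|_]; last by rewrite mulr0.
by case/eqP: neA; apply: val_inj; rewrite SubK.
Qed.

Lemma pairingD phi c c' : pairing phi (fun A => c A + c' A) = pairing phi c + pairing phi c'.
Proof. by rewrite /pairing -big_split; apply: eq_bigr => A _; rewrite mulrDr. Qed.

Lemma pairingN phi c : pairing phi (fun A => - c A) = - pairing phi c.
Proof. by rewrite /pairing -sumrN; apply: eq_bigr => A _; rewrite mulrN. Qed.

Lemma pairingZ phi x c : pairing phi (fun A => x * c A) = x * pairing phi c.
Proof. by rewrite /pairing big_distrr; apply: eq_bigr => A _; rewrite mulrCA. Qed.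

Lemma pairing_sum (I : finType) (P : pred I) phi (a : I -> int) (c : I -> pairs2 V -> int) :
  pairing phi (fun A => \sum_(i | P i) a i * c i A) = \sum_(i | P i) a i * pairing phi (c i).
Proof.
rewrite /pairing; under eq_bigr do rewrite big_distrr; rewrite exchange_big /=.
by apply: eq_bigr => i _; rewrite big_distrr; apply: eq_bigr => A _; rewrite mulrCA.
Qed.

Definition side_ind (f : V * V) (A : {set V}) : int := (A \subset side f)%:R.

(** The numbers [x], [y] and [z g] are the coordinates of the image of the vector [c] under the
    matrix [U]. *)
Definition dual_pairings (c : pairs2 V -> int) (x y : int) (z : V * V -> int) : Prop :=
  [/\ pairing (fun A => (dist_set A)%:Z) c = x, pairing (fun=> 1) c = y &
      forall g, g \in inner_arcs -> pairing (side_ind g) c = z g].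

(* The sets [{u, v}] and [{v, w}] lie on the same sides of all arcs but [(u, w)]. *)
Lemma dual_path u v w : e u v -> e u w -> v != w ->
  exists c, dual_pairings c (-1) 0 (fun g => (g == (u, w))%:R).
Proof.
move=> euv euw vw; have evu : e v u by rewrite tree_sym.
have uv : u != v by apply: contraTneq euv => ->; rewrite tree_irr.
have duv : d u v = 1%N by case: (dist_edge u euv); rewrite dist_xx.
have dvu : d v u = 1%N by rewrite dist_sym.
have dvw : d v w = 2%N.
  by have := dist_eq0 v w; rewrite (negPf vw); have := dist_edge v euw; lia.
have uv2 : #|[set u; v]| == 2 by rewrite cards2 uv.
have vw2 : #|[set v; w]| == 2 by rewrite cards2 vw.
exists (fun A => set_dirac [set u; v] A + - set_dirac [set v; w] A).
split=> [||g]; rewrite pairingD pairingN !pairing_dirac //.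
  by rewrite !dist_set2 // duv dvw.
rewrite in_set => /andP [gA _]; rewrite /side_ind !sub_set2.
have [->|ne] := eqVneq g (u, w).
  rewrite !in_set /= dvu dvw !dist_xx lt0n dist_eq0 (contraTneq _ euw) // => ->.
  by rewrite tree_irr.
case: g gA ne => s t; rewrite in_set /= => est ne.
have [vg|vg] := boolP (v \in side (s, t)); last by rewrite andbF subrr.
have [ug|ug] := boolP (u \in side (s, t)); have [wg|wg] := boolP (w \in side (s, t)) => //.
  by have [us wt] := side_cross est euw ug wg; rewrite us wt eqxx in ne.
have ewu : e w u by rewrite tree_sym.
have [vs _] := side_cross est evu vg ug; have [ws _] := side_cross est ewu wg ug.
by rewrite vs ws eqxx in vw.
Qed.

Lemma dual_dist : (3 <= #|V|)%N -> exists c, dual_pairings c 1 0 (fun=> 0).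
Proof.
case/exists_leaf_path => l [u [v [lL _ eul euv vl]]].
have [c [cd c1 cg]] := dual_path euv eul vl.
exists (fun A => - c A); split=> [||g gI]; rewrite pairingN ?cd ?c1 ?oppr0 //.
rewrite cg //; case: eqP => [gul|_]; last by rewrite oppr0.
by move: gI; rewrite gul in_set lL !andbF.
Qed.

Lemma dual_arc f : (3 <= #|V|)%N -> f \in inner_arcs ->
  exists c, dual_pairings c 0 0 (fun g => (g == f)%:R).
Proof.
case: f => u w V3; rewrite in_set => /andP []; rewrite in_set /= => euw /andP [uN _].
have [v euv vw] := nonleaf_other_nbr uN euw.
have [c [cd c1 cg]] := dual_path euv euw vw.
have [c' [cd' c1' cg']] := dual_dist V3.
exists (fun A => c A + c' A).
by split=> [||g gI]; rewrite pairingD ?cd ?cd' ?c1 ?c1' ?addr0 // cg // cg' // addr0.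
Qed.

(** The indicator of one pair has value 1 on the constant functional; subtracting multiples of the
    other dual vectors clears its remaining coordinates. *)
Lemma dual_one : (3 <= #|V|)%N -> exists c, dual_pairings c 0 1 (fun=> 0).
Proof.
move=> V3; have [l [u [_ [_ _ eul _ _]]]] := exists_leaf_path V3.
have ul2 : #|[set u; l]| == 2.
  by rewrite cards2 (contraTneq _ eul) // => ->; rewrite tree_irr.
have [cd [cdd cd1 cdg]] := dual_dist V3.
(* Choosing the vectors simultaneously requires one for every [f]; zero serves outside
   [inner_arcs]. *)
have : forall f, exists c, f \in inner_arcs -> dual_pairings c 0 0 (fun g => (g == f)%:R).
  move=> f; have [fI|_] := boolP (f \in inner_arcs); last by exists (fun=> 0).
  by have [c ?] := dual_arc V3 fI; exists c.
case/fin_all_exists => c cP.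
pose a f := side_ind f [set u; l]; pose x := (dist_set [set u; l])%:Z.
exists (fun A => set_dirac [set u; l] A +
  - (\sum_(f in inner_arcs) a f * c f A + x * cd A)).
split=> [||g gI]; rewrite pairingD pairingN pairingD pairing_sum pairingZ pairing_dirac //.
- rewrite cdd big1 => [|f /cP [-> _ _]]; last by rewrite mulr0.
  by rewrite add0r mulr1 subrr.
- rewrite cd1 big1 => [|f /cP [_ -> _]]; last by rewrite mulr0.
  by rewrite mulr0 addr0.
rewrite cdg // mulr0 addr0 (bigD1 g) //= big1 => [|f /andP [fI fg]].
  by have [_ _ ->] := cP g gI; rewrite // eqxx mulr1 addr0 subrr.
by have [_ _ ->] := cP f fI; rewrite // eq_sym (negPf fg) mulr0.
Qed.

(** * Entries as a bilinear form in the functionals *)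

Lemma max4pc_entry_inner (A B : {set V}) : #|A| == 2 -> #|B| == 2 ->
  (max4pc_entry e A B)%:Z = (dist_set A)%:Z + (dist_set B)%:Z
    + \sum_(f in inner_arcs) side_ind (rev_arc f) A * 2 * side_ind f B.
Proof.
move=> A2 B2; rewrite max4pc_entryE // sum_inner_arcs //.
(* Reversing the arcs identifies the two sums, which produces the weight 2. *)
have -> : (\sum_(f in inner_arcs) (A \subset side f) * (B \subset side (rev_arc f))
    = \sum_(f in inner_arcs) (A \subset side (rev_arc f)) * (B \subset side f))%N.
  rewrite (reindex_inj (inv_inj rev_arcK)); apply: eq_big => f.
    exact: rev_inner_arcs.
  by rewrite rev_arcK.
have -> : (\sum_(f in arcs) (A \subset side (rev_arc f)) * (B \subset side f)
    = \sum_(f in inner_arcs) (A \subset side (rev_arc f)) * (B \subset side f))%N.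
  under eq_bigr do rewrite mulnC; rewrite sum_inner_arcs //.
  by apply: eq_bigr => f _; rewrite mulnC.
rewrite -big_split !PoszD; congr (_ + _ + _); rewrite -natz natr_sum.
apply: eq_bigr => f _; rewrite /= addnn -mul2n !natrM.
by rewrite /side_ind mulrCA mulrA.
Qed.

Definition functional_index := (bool + {f : V * V | f \in inner_arcs})%type.

Definition functional (t : functional_index) (A : {set V}) : int :=
  match t with
  | inl true => (dist_set A)%:Z
  | inl false => 1
  | inr f => side_ind (val f) A
  end.

(** This is the permutation hidden in [K]: the distance is matched with the constant, and each arc
    with its reverse. *)
Definition functional_swap (t : functional_index) : functional_index :=
  match t with
  | inl b => inl (~~ b)
  | inr f => inr (Sub (rev_arc (val f)) (etrans (rev_inner_arcs (val f)) (valP f)))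
  end.

Definition functional_weight (t : functional_index) : int := if t is inl _ then 1 else 2.

Lemma functional_swap_inj : injective functional_swap.
Proof.
move=> [b|f] [b'|f'] //= []; first by move/negb_inj ->.
move=> e2 e1; congr inr; apply: val_inj => /=.
by rewrite [LHS]surjective_pairing e1 e2 -surjective_pairing.
Qed.

Lemma functional_dual : (3 <= #|V|)%N -> exists c : functional_index -> pairs2 V -> int,
  forall t u, pairing (functional t) (c u) = (t == u)%:R.
Proof.
move=> V3.
suff /fin_all_exists [c cP] : forall u : functional_index, exists c : pairs2 V -> int,
    forall t, pairing (functional t) c = (t == u)%:R by exists c.
have [c1 [c1d c1o c1g]] := dual_one V3; have [cd [cdd cdo cdg]] := dual_dist V3.
move=> [[]|f].
- by exists cd => -[[]|g] /=; rewrite ?cdd ?cdo ?cdg //; apply: valP.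
- by exists c1 => -[[]|g] /=; rewrite ?c1d ?c1o ?c1g //; apply: valP.
have [c [cfd cf1 cfg]] := dual_arc V3 (valP f).
by exists c => -[[]|g] /=; rewrite ?cfd ?cf1 ?cfg //; apply: valP.
Qed.

Lemma max4pc_entry_functional (A B : {set V}) : #|A| == 2 -> #|B| == 2 ->
  (max4pc_entry e A B)%:Z
  = \sum_t functional (functional_swap t) A * functional_weight t * functional t B.
Proof.
move=> A2 B2; rewrite max4pc_entry_inner // big_sumType big_bool /= !mulr1 mul1r.
by rewrite [X in X + _]addrC big_sub.
Qed.

(** The distance and the constant come first, so that the weights read 1, 1, 2, ..., 2. *)
Definition functional_of_ord (j : 'I_(2 + #|{: {f : V * V | f \in inner_arcs}}|)) :
    functional_index :=
  match split j with inl i => inl (i == 0) | inr i => inr (enum_val i) end.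

Lemma functional_of_ord_bij : bijective functional_of_ord.
Proof.
exists (fun t => unsplit (match t with inl b => inl (if b then 0 else 1) | inr f => inr (enum_rank f) end)).
  move=> j; rewrite /functional_of_ord; case: (split_ordP j) => i -> /=.
    by rewrite /unsplit; congr lshift; case: i => [[|[]]] //= ?; apply: val_inj.
  by rewrite enum_valK.
rewrite /functional_of_ord => -[b|f]; rewrite unsplitK; first by case: b.
by rewrite enum_rankK.
Qed.

End TreeMetric.

(** * The invariant factors *)

Local Open Scope ring_scope.

Theorem mainTheorem4 (V : finType) (e : rel V) (n p : nat) :
  is_tree e -> #|V| = n -> (3 <= n)%N -> #|leaves e| = p ->
  exists2 L : 'M[int]_(#|{: pairs2 V}|), L \in unitmx &
  exists2 R : 'M[int]_(#|{: pairs2 V}|), R \in unitmx &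
    Max4PC e = L *m diag_seq _
      (nseq 2 (1%R : int) ++ nseq ((2 * (n - p - 1))%N) (2%R : int)
        ++ nseq (('C(n, 2) - 2 * (n - p))%N) (0%R : int)) *m R.
Proof.
move=> tree <- V3 <-; rewrite -(card_inner_arcs tree V3).
have [c dual] := functional_dual tree V3.
apply: (smith_of_dual_systems (T := functional_index e) (tau := @functional_swap V e tree)
  (phi := fun t i => functional t (val (enum_val i)))
  (c := fun t i => c t (enum_val i)) (ev := @functional_weight V e)
  (functional_of_ord_bij e) (@functional_swap_inj V e tree)).
- move=> t u; rewrite -dual /pairing.
  rewrite (reindex (fun i : 'I_#|{: pairs2 V}| => enum_val i)) //.
  exact/onW_bij/enum_val_bij.
- move=> j; rewrite /functional_of_ord !nth_cat !nth_nseq !size_nseq.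
  case: (split_ordP j) => i ej //=.
  by rewrite ej /= addKn -(card_sig (mem (inner_arcs e))) ltn_ord.
(* Past the first two blocks all entries are zero: within the last block by its value, and after its
   end by the default of [nth]. *)
- move=> i le; have {le} : (2 + #|inner_arcs e| <= i)%N.
    by rewrite -(card_sig (mem (inner_arcs e))).
  move=> le; rewrite !nth_cat !nth_nseq !size_nseq.
  have -> : (i < 2)%N = false by lia.
  have -> : (i - 2 < #|inner_arcs e|)%N = false by lia.
  by rewrite if_same.
by move=> i j; rewrite mxE (max4pc_entry_functional tree (valP (enum_val i)) (valP (enum_val j))).
Qed.
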